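(* Let $k$ be an algebraically closed field. For integers $n\ge 2$ and $d\ge 1$, let $D(n,d)$ be the set of all degrees of the inverses $\phi^{-1}$, as $\phi$ ranges over all monomial Cremona transformations of $\mathbb{P}^n_k$ of degree $d$. Then $D(n,d)$ is not always an interval of integers: there exist $n\ge 2$ and $d\ge 1$ and integers $a<b<c$ such that $a,c\in D(n,d)$ and $b\notin D(n,d)$.
   Context: A Cremona transformation is a birational map $\mathbb{P}^n_k\dashrightarrow\mathbb{P}^n_k$; it is monomial if it can be given by $(x_0:\dots:x_n)\mapsto(g_0:\dots:g_n)$ with the $g_i$ monomials (coefficient $1$) of the same degree. Its degree is the common degree of the homogeneous polynomials defining it once all common nonconstant factors have been canceled. *)

(* Defs.v *)
From HB Require Import structures.
From mathcomp Require Import all_boot all_order all_algebra.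
From mathcomp.multinomials Require Import mpoly.
Set Implicit Arguments.
Unset Strict Implicit.
Unset Printing Implicit Defensive.
Import GRing.Theory.
Local Open Scope ring_scope.

Section RationalMaps.
Variables (k : closedFieldType) (n : nat).

(* Tuples (g_0, ..., g_n) of polynomials in the n + 1 homogeneous coordinates
   x_0, ..., x_n of P^n. *)
Definition forms := (n.+1).-tuple {mpoly k[n.+1]}.

(* (g_0 : ... : g_n) with all g_i homogeneous of degree d, not all zero.
   The zero polynomial is d.-homog for every d. *)
Definition represents_map_of_deg (d : nat) (g : forms) : Prop :=
  (forall i, tnth g i \is d.-homog) /\ (exists i, tnth g i != 0).

(* Rational maps P^n --> P^n are handled through their representatives, and
   compared with [same_map] rather than with Leibniz equality. *)
Definition rational_map (g : forms) : Prop :=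
  exists d, represents_map_of_deg d g.

Definition same_map (g h : forms) : Prop :=
  forall i j, tnth g i * tnth h j = tnth g j * tnth h i.

Definition id_map : forms := [tuple 'X_i | i < n.+1].

(* g o f, i.e. (g_0(f_0, ..., f_n), ..., g_n(f_0, ..., f_n)) *)
Definition comp_forms (g f : forms) : forms :=
  [tuple tnth g i \mPo f | i < n.+1].

(* g o f is defined and equals the identity. When g o f vanishes identically
   [same_map] would hold vacuously, hence the first conjunct. *)
Definition comp_is_id (g f : forms) : Prop :=
  rational_map (comp_forms g f) /\ same_map (comp_forms g f) id_map.

Definition inverse_map (f g : forms) : Prop :=
  [/\ rational_map g, comp_is_id g f & comp_is_id f g].

Definition cremona (f : forms) : Prop :=
  rational_map f /\ exists g, inverse_map f g.

Definition monomial_map (f : forms) : Prop :=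
  exists (e : nat) (m : (n.+1).-tuple 'X_{1..n.+1}),
    (forall i, mdeg (tnth m i) = e) /\
    same_map f [tuple 'X_[tnth m i] | i < n.+1].

Definition common_factor (q : {mpoly k[n.+1]}) (h : forms) : Prop :=
  forall i, exists r, tnth h i = q * r.

Definition no_nonconstant_common_factor (h : forms) : Prop :=
  forall q, common_factor q h -> exists a : k, q = a%:MP.

(* f = c h with c the cancelled factor. *)
Definition has_degree (f : forms) (d : nat) : Prop :=
  exists (c : {mpoly k[n.+1]}) (h : forms),
    [/\ forall i, tnth f i = c * tnth h i,
        represents_map_of_deg d h & no_nonconstant_common_factor h].

End RationalMaps.

(* [inverse_degrees k n d] is the set D(n, d), as a predicate on nat. *)
Definition inverse_degrees (k : closedFieldType) (n d e : nat) : Prop :=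
  exists f g : forms k n,
    [/\ cremona f, monomial_map f, has_degree f d,
        inverse_map f g & has_degree g e].

(* Main.v *)
(* Up to a common factor, a birational monomial map has a monomial inverse: if
   the components of f are X^(a i) and g o f = id, the leading exponents of the
   components of g o f differ by unit vectors, which yields exponents e i of g
   inverting a; then f o g = id forces g to be proportional to X^e. The degrees
   of both maps are read off the exponents once common variables are removed.

   For n = 3 the exponents of a monomial Cremona transformation of degree d are
   the vertices of a unimodular tetrahedron inscribed in the d-fold dilated
   standard simplex, and inverting a 3x3 matrix of determinant 1 or -1 gives the
   degree of the inverse. An exhaustive search over the tetrahedra with d = 5
   shows that the inverse degree 18 is missed, while 17 and 19 occur. *)
From Stdlib Require Import ZArith List.
Require Import Defs.
From mathcomp Require Import all_boot all_order all_algebra.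
From mathcomp Require Import zify.
From mathcomp.multinomials Require Import mpoly.
Set Implicit Arguments.
Unset Strict Implicit.
Unset Printing Implicit Defensive.
Import GRing.Theory.

(** * Divisibility by monomials and leading exponents *)

Section Monomials.
Local Open Scope ring_scope.
Variables (R : idomainType) (n : nat).
Implicit Types (p q : {mpoly R[n]}) (a b m : 'X_{1..n}).

Lemma mpolyX_neq0 m : 'X_[m] != 0 :> {mpoly R[n]}.
Proof. by rewrite -msupp_eq0 msuppX. Qed.

Lemma mpolyX_dvd p b :
  {in msupp p, forall m, (b <= m)%MM} -> exists q, p = q * 'X_[b].
Proof.
move=> bp; exists (\sum_(m <- msupp p) p@_m *: 'X_[m - b]).
rewrite mulr_suml {1}(mpolyE p) big_seq [RHS]big_seq.
by apply: eq_bigr => m mp; rewrite -scalerAl -mpolyXD submK ?bp.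
Qed.

Lemma msupp_mulX_eq p q a b m :
  p * 'X_[a] = q * 'X_[b] -> m \in msupp p -> (b <= a + m)%MM.
Proof.
move=> pq mp; have : (a + m)%MM \in msupp (q * 'X_[b]).
  by rewrite -pq mcoeff_msupp mcoeffMX -mcoeff_msupp.
by rewrite (perm_mem (msuppMX _ _)) => /mapP[m' _ ->]; rewrite lem_addr.
Qed.

Lemma mlead_factor_le q p b : q * p = 'X_[b] -> (mlead q <= b)%MM.
Proof.
move=> qp; have := mpolyX_neq0 b; rewrite -qp mulf_eq0 => /norP[q0 p0].
by rewrite -[b](mleadXm R) -qp mleadM // lem_addr.
Qed.

Lemma mlead_eq0_const q : mlead q = 0%MM -> exists c : R, q = c%:MP.
Proof.
have [->|q0] := eqVneq q 0; first by exists 0; rewrite mpolyC0.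
move=> lq; exists (q@_0%MM); apply: msize1_polyC.
by rewrite -mlead_deg // lq mdeg0.
Qed.

End Monomials.

(** * Reduced exponents of monomial maps and of their inverses *)

Section MonomialMaps.
Local Open Scope ring_scope.
Variables (k : closedFieldType) (n : nat).
Implicit Types (a b : 'I_n.+1 -> 'X_{1..n.+1}) (f g h : forms k n).
Implicit Types (p q : {mpoly k[n.+1]}) (m : 'X_{1..n.+1}).

Definition monomial_forms a : forms k n := [tuple 'X_[a i] | i < n.+1].

Definition no_common_variable a := forall v, exists i, a i v = 0%N.

(* The exponent of the monomial obtained from ['X_[m]] by substituting
   ['X_[a v]] for ['X_v]. *)
Definition subst_exponent a m : 'X_{1..n.+1} := (\sum_v a v *+ m v)%MM.

Lemma mons_subst a m :
  'X_[m] \mPo monomial_forms a = 'X_[subst_exponent a m].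
Proof.
rewrite comp_mpolyX /subst_exponent -mprodXnE.
by apply: eq_bigr => v _; rewrite tnth_mktuple.
Qed.

Lemma subst_exponentE a m w : subst_exponent a m w = (\sum_v a v w * m v)%N.
Proof. by rewrite mnm_sumE; apply: eq_bigr => v _; rewrite mulmnE. Qed.

(** The leading exponent of a common factor lies below every [a i], hence is zero; the monomial
    order refines the degree, so the factor is constant. *)
Lemma no_common_variable_coprime a :
  no_common_variable a -> no_nonconstant_common_factor (monomial_forms a).
Proof.
move=> a0 q qa; apply: mlead_eq0_const; apply/mnmP => v; rewrite mnm0E.
have [i ai] := a0 v; have [r] := qa i; rewrite tnth_mktuple => /esym/mlead_factor_le.
by move/mnm_lepP/(_ v); rewrite ai leqn0 => /eqP.
Qed.

Lemma coprime_monomial_map h a :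
    no_nonconstant_common_factor h -> (exists i, tnth h i != 0) ->
    same_map h (monomial_forms a) ->
  exists c b, [/\ c != 0, no_common_variable b,
    forall i, tnth h i = c *: 'X_[b i] &
    forall i j, (b i + a j = b j + a i)%MM].
Proof.
move=> coph [i0 hi0] ha.
pose s v := [arg min_(i < ord0 | true) a i v]%N.
have sP v i : (a (s v) v <= a i v)%N by rewrite /s; case: arg_minnP => // j _; apply.
pose mu : 'X_{1..n.+1} := [multinom a (s v) v | v < n.+1].
have mua i : (mu <= a i)%MM by apply/mnm_lepP => v; rewrite mnmE.
pose b i := (a i - mu)%MM.
have ab i : a i = (b i + mu)%MM by rewrite submK.
have bb i j : (b i + a j = b j + a i)%MM.
  by rewrite [in LHS]ab [in RHS]ab !addmA [(b i + _)%MM]addmC.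
have hX i j : tnth h i * 'X_[a j] = tnth h j * 'X_[a i].
  by have := ha i j; rewrite !tnth_mktuple.
(* For each variable [v], comparing [h i] with the component [s v] whose exponent in [v] is least
   bounds the exponent of [v] in [h i] from below by [b i v]. *)
have /fin_all_exists[q hq] i : exists q, tnth h i = q * 'X_[b i].
  apply: mpolyX_dvd => m mh; apply/mnm_lepP => v; rewrite mnmBE mnmE.
  have /mnm_lepP/(_ v) := msupp_mulX_eq (hX i (s v)) mh.
  by rewrite mnmDE leq_subLR.
(* The quotient is the same for all [i], so it is a common factor of [h], hence constant. *)
have qE i : q i = q i0.
  apply: (mulIf (mpolyX_neq0 k (b i + a i0))).
  by rewrite {2}bb !mpolyXD !mulrA -!hq hX.
have [r|c qc] := coph (q i0); first by exists 'X_[b r]; rewrite hq qE.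
exists c, b; split=> //.
- by apply: contraNneq hi0 => c0; rewrite hq qc c0 mpolyC0 mul0r.
- by move=> v; exists (s v); rewrite mnmBE mnmE subnn.
- by move=> i; rewrite hq qE qc mul_mpolyC.
Qed.

Lemma same_map_scale f h g c :
    c != 0 -> (forall i, tnth f i = c * tnth h i) -> same_map f g ->
  same_map h g.
Proof.
move=> c0 fh fg i j; apply: (mulfI c0).
by rewrite !mulrA -!fh fg.
Qed.

Lemma has_degree_monomial f a d :
    has_degree f d -> (exists i, tnth f i != 0) ->
    same_map f (monomial_forms a) ->
  exists c b, [/\ c != 0, no_common_variable b, forall i, mdeg (b i) = d,
    forall i, tnth f i = c * 'X_[b i] &
    forall i j, (b i + a j = b j + a i)%MM].
Proof.
case=> c [h [fh [homh h0] coph]] [i fi] fa.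
have c0 : c != 0 by apply: contraNneq fi => c0; rewrite fh c0 mul0r.
have [e [b [e0 b0 hb ba]]] := coprime_monomial_map coph h0 (same_map_scale c0 fh fa).
exists (c * e%:MP), b; split=> //.
- by rewrite mulf_neq0 ?mpolyC_eq0.
- move=> j; have := homh j; rewrite hb dhomogE.
  by rewrite msuppMCX //= andbT => /eqP.
- by move=> j; rewrite fh hb -mulrA mul_mpolyC.
Qed.

(** Every monomial of [p] has [d] factors, each contributing one [c]. *)
Lemma comp_scaled_monomial_forms p f a c d :
    p \is d.-homog -> (forall i, tnth f i = c * 'X_[a i]) ->
  p \mPo f = c ^+ d * (p \mPo monomial_forms a).
Proof.
move=> /dhomogP hp fE; rewrite !comp_mpolyEX mulr_sumr big_seq [RHS]big_seq.
apply: eq_bigr => m /hp mdeg_d; rewrite -scalerAr; congr (_ *: _).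
have {mdeg_d} <- : mdeg m = d by [].
rewrite !comp_mpolyX mdegE -prodrXr -big_split /=.
by apply: eq_bigr => v _; rewrite fE tnth_mktuple exprMn.
Qed.

(** Monomials are sent to monomials, so whatever survives cancellation, the leading term included,
    comes from the support of [p]. *)
Lemma mlead_comp_monomial_forms p a :
    p \mPo monomial_forms a != 0 ->
  exists2 m, m \in msupp p & mlead (p \mPo monomial_forms a) = subst_exponent a m.
Proof.
move/mlead_supp; rewrite {2}comp_mpolyEX => /msupp_sum_le /flatten_mapP[m].
rewrite filter_predT => mp /msuppZ_le; rewrite mons_subst msuppX inE => /eqP.
by exists m.
Qed.

Lemma same_id_map_neq0 h i :
  (exists i, tnth h i != 0) -> same_map h (id_map k n) -> tnth h i != 0.
Proof.
case=> j hj hid; apply: contraNneq (mulf_neq0 hj (mpolyX_neq0 k U_(i))) => hi.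
by have := hid i j; rewrite !tnth_mktuple hi mul0r => <-.
Qed.

(* The leading exponents of the components of g o f, which is proportional to
   the identity, differ by unit vectors; they come from exponents of g. *)
Lemma left_inverse_exponents f g a c d :
    (forall i, tnth f i = c * 'X_[a i]) -> (forall i, tnth g i \is d.-homog) ->
    comp_is_id g f ->
  exists e : 'I_n.+1 -> 'X_{1..n.+1}, (forall i, mdeg (e i) = d) /\
    forall i j, (subst_exponent a (e i) + U_(j) = subst_exponent a (e j) + U_(i))%MM.
Proof.
move=> fE homg [[D [_ gf0]] gfid].
have gfE i : tnth (comp_forms g f) i = c ^+ d * (tnth g i \mPo monomial_forms a).
  by rewrite tnth_mktuple (comp_scaled_monomial_forms (homg i) fE).
have cG0 i := same_id_map_neq0 i gf0 gfid.
have c0 : c ^+ d != 0 by have := cG0 ord0; rewrite gfE mulf_eq0 negb_or => /andP[].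
have G0 i : tnth g i \mPo monomial_forms a != 0.
  by have := cG0 i; rewrite gfE mulf_eq0 negb_or => /andP[].
have /fin_all_exists2[e eg leadG] i := mlead_comp_monomial_forms (G0 i).
exists e; split=> [i|i j]; first exact: (dhomogP _ _ _ (homg i)).
rewrite -!leadG -[U_(j)%MM](mleadXm k) -[U_(i)%MM](mleadXm k).
rewrite -!mleadM ?mpolyX_neq0 //; congr mlead; apply: (mulfI c0).
by have := gfid i j; rewrite !mulrA -!gfE !tnth_mktuple.
Qed.

(** The ratio [y j / 'X_j] does not depend on [j]; the identity is its power of exponent [mdeg m],
    with denominators cleared. *)
Lemma prod_same_id_map (y : 'I_n.+1 -> {mpoly k[n.+1]}) i m :
    (forall j, y j * 'X_i = y i * 'X_j) ->
  \prod_j y j ^+ m j * 'X_i ^+ mdeg m = y i ^+ mdeg m * 'X_[m].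
Proof.
move=> yX; rewrite [in RHS]mpolyXE_id mdegE -!prodrXr -!big_split /=.
by apply: eq_bigr => j _; rewrite -!exprMn yX.
Qed.

(* Substituting f o g = id into the monomials X^(e i) turns the exponent
   relations of [left_inverse_exponents] into proportionality of g and X^e. *)
Lemma inverse_same_monomial f g a e c d :
    (forall i, tnth f i = c * 'X_[a i]) -> comp_is_id f g ->
    (forall i, mdeg (e i) = d) ->
    (forall i j, (subst_exponent a (e i) + U_(j) = subst_exponent a (e j) + U_(i))%MM) ->
  same_map g (monomial_forms e).
Proof.
move=> fE [[D [_ fg0]] fgid] mdege ae l j; rewrite !tnth_mktuple.
pose y i := 'X_[a i] \mPo g.
have fgE i : tnth (comp_forms f g) i = (c \mPo g) * y i.
  by rewrite tnth_mktuple fE rmorphM.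
have cy0 i := same_id_map_neq0 i fg0 fgid.
have cg0 : c \mPo g != 0.
  by have := cy0 ord0; rewrite fgE mulf_eq0 negb_or => /andP[].
have y0 i : y i != 0.
  by have := cy0 i; rewrite fgE mulf_eq0 negb_or => /andP[].
have yX i0 i : y i * 'X_i0 = y i0 * 'X_i.
  apply: (mulfI cg0); rewrite !mulrA -!fgE.
  by have := fgid i i0; rewrite !tnth_mktuple.
pose N i := subst_exponent a (e i).
have yN i : \prod_v y v ^+ (e i) v = 'X_[N i] \mPo g.
  rewrite /N /subst_exponent -mprodXnE rmorph_prod.
  by apply: eq_bigr => v _; rewrite rmorphXn.
have N0 i : 'X_[N i] \mPo g != 0.
  by rewrite -yN; apply/prodf_neq0 => v _; rewrite expf_neq0.
(* The relation [ae], evaluated at [g], makes [g] proportional to the values ['X_[N i] \mPo g]; [NX]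
   says the same of the monomials ['X_[e i]]. *)
have Ng : ('X_[N l] \mPo g) * tnth g j = ('X_[N j] \mPo g) * tnth g l.
  by rewrite !(tnth_nth 0) -!comp_mpolyXU -!rmorphM -!mpolyXD ae.
have NX : ('X_[N l] \mPo g) * 'X_[e j] = ('X_[N j] \mPo g) * 'X_[e l].
  apply: (mulIf (expf_neq0 d (mpolyX_neq0 k U_(ord0)))).
  have E i : ('X_[N i] \mPo g) * 'X_ord0 ^+ d = y ord0 ^+ d * 'X_[e i].
    by rewrite -yN -(mdege i); apply: prod_same_id_map => v; apply: yX.
  by rewrite mulrAC E [in RHS]mulrAC E mulrAC.
apply: (mulfI (N0 j)).
by rewrite mulrA -Ng mulrAC NX mulrAC mulrA.
Qed.

(** * Dictionary between inverse maps and inverse families of exponents *)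

Lemma subst_exponentD a m1 m2 :
  subst_exponent a (m1 + m2) = (subst_exponent a m1 + subst_exponent a m2)%MM.
Proof.
apply/mnmP => w; rewrite mnmDE !subst_exponentE -big_split /=.
by apply: eq_bigr => v _; rewrite mnmDE mulnDr.
Qed.

Lemma mdeg_subst_exponent a m d :
  (forall v, mdeg (a v) = d) -> mdeg (subst_exponent a m) = (d * mdeg m)%N.
Proof.
move=> da; rewrite mdeg_sum [mdeg m]mdegE big_distrr /=.
by apply: eq_bigr => v _; rewrite mdegMn da.
Qed.

(* The monomial map X^b o X^a is the identity of projective space. *)
Definition left_inverse_exponent b a := forall i j,
  (subst_exponent a (b i) + U_(j) = subst_exponent a (b j) + U_(i))%MM.

Lemma monomial_rational_map a d :
  (forall i, mdeg (a i) = d) -> represents_map_of_deg d (monomial_forms a).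
Proof.
move=> da; split=> [i|]; first by rewrite tnth_mktuple dhomogX; apply/eqP/da.
by exists ord0; rewrite tnth_mktuple mpolyX_neq0.
Qed.

Lemma monomial_comp_is_id a b d e :
    (forall i, mdeg (a i) = d) -> (forall i, mdeg (b i) = e) ->
    left_inverse_exponent b a ->
  comp_is_id (monomial_forms b) (monomial_forms a).
Proof.
move=> da eb ba.
have compE : comp_forms (monomial_forms b) (monomial_forms a) =
             monomial_forms (fun i => subst_exponent a (b i)).
  by apply: eq_from_tnth => i; rewrite !tnth_mktuple mons_subst.
split; rewrite compE.
  exists (d * e)%N; apply: monomial_rational_map => i.
  by rewrite (mdeg_subst_exponent _ da) eb.
by move=> i j; rewrite !tnth_mktuple -!mpolyXD ba.
Qed.

Lemma monomial_has_degree a d :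
    (forall i, mdeg (a i) = d) -> no_common_variable a ->
  has_degree (monomial_forms a) d.
Proof.
move=> da a0; exists 1, (monomial_forms a); split=> [i||].
- by rewrite mul1r.
- exact: monomial_rational_map.
- exact: no_common_variable_coprime.
Qed.

Lemma inverse_degrees_of_exponents a b d e :
    (forall i, mdeg (a i) = d) -> (forall i, mdeg (b i) = e) ->
    no_common_variable a -> no_common_variable b ->
    left_inverse_exponent b a -> left_inverse_exponent a b ->
  inverse_degrees k n d e.
Proof.
move=> da eb a0 b0 ba ab.
have inv : inverse_map (monomial_forms a) (monomial_forms b).
  split; first by exists e; apply: monomial_rational_map.
    exact: (monomial_comp_is_id da eb).
  exact: (monomial_comp_is_id eb da).
exists (monomial_forms a), (monomial_forms b); split=> //.
- by split; [exists d; apply: monomial_rational_map | exists (monomial_forms b)].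
- exists d, [tuple a i | i < n.+1].
  by split=> [i|i j]; rewrite !tnth_mktuple // mulrC.
- exact: monomial_has_degree.
- exact: monomial_has_degree.
Qed.

Lemma exponents_of_inverse_degrees d e :
  inverse_degrees k n d e ->
  exists a b, [/\ forall i, mdeg (a i) = d, forall i, mdeg (b i) = e,
    no_common_variable a, no_common_variable b & left_inverse_exponent b a].
Proof.
case=> f [g [[[? [_ f0]] _] [? [m [_ fm]]] fd [[? [homg g0]] gf fg] ge]].
have [c [a [_ a0 da fE _]]] := has_degree_monomial fd f0 fm.
have [s [ds sa]] := left_inverse_exponents fE homg gf.
have gs := inverse_same_monomial fE fg ds sa.
have [_ [b [_ b0 eb _ bs]]] := has_degree_monomial ge g0 gs.
exists a, b; split=> // i j.
(* By [bs], [b] and [s] differ by a common shift; [subst_exponent a] is additive, so [sa] passes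
   from [s] to [b]. *)
have := congr1 (subst_exponent a) (bs i j); rewrite !subst_exponentD => bsa.
apply: (@addIm _ (subst_exponent a (s j))).
rewrite -addmA [(U_(j) + _)%MM]addmC addmA bsa -addmA sa.
by rewrite -!addmA [(U_(i) + _)%MM]addmC.
Qed.

End MonomialMaps.

(** * Integer matrices and the exhaustive search *)

Section DegreeGap.
Local Open Scope Z_scope.

Local Arguments Z.mul : simpl never.
Local Arguments Z.add : simpl never.

Definition vec : Type := Z * Z * Z.
Definition dot (u v : vec) :=
  let '(u0, u1, u2) := u in let '(v0, v1, v2) := v in u0 * v0 + u1 * v1 + u2 * v2.
Definition cross (u v : vec) : vec :=
  let '(u0, u1, u2) := u in let '(v0, v1, v2) := v in
  (u1 * v2 - u2 * v1, u2 * v0 - u0 * v2, u0 * v1 - u1 * v0).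
Definition sub (u v : vec) : vec :=
  let '(u0, u1, u2) := u in let '(v0, v1, v2) := v in (u0 - v0, u1 - v1, u2 - v2).

Definition max4 a b c d := Z.max a (Z.max b (Z.max c d)).

(* The power of a variable that clears the negative exponents s w of its
   occurrences; the entry 0 is the exponent at the base row. *)
Definition depth s (w : vec) :=
  let '(w0, w1, w2) := w in max4 0 (- (s * w0)) (- (s * w1)) (- (s * w2)).

(* The rows of exponents, in the affine chart that forgets the last coordinate,
   are b, b + u, b + v, b + t; with s = det (u, v, t) = 1 or -1, the columns of
   the inverse of the matrix with rows u, v, t are s (v x t), s (t x u) and
   s (u x v). *)
Definition inverse_degree s (u v t : vec) :=
  let '(x0, x1, x2) := cross v t in let '(y0, y1, y2) := cross t u in
  let '(z0, z1, z2) := cross u v in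
  depth s (x0, x1, x2) + depth s (y0, y1, y2) + depth s (z0, z1, z2)
  + depth s (- (x0 + y0 + z0), - (x1 + y1 + z1), - (x2 + y2 + z2)).

(** No variable divides all four monomials: each coordinate, the last being [d] minus the sum of the
    others, has minimum 0 over the vertices. *)
Definition touches_facets d (b u v t : vec) :=
  let '(b0, b1, b2) := b in let '(u0, u1, u2) := u in
  let '(v0, v1, v2) := v in let '(t0, t1, t2) := t in
  (b0 =? max4 0 (- u0) (- v0) (- t0)) && (b1 =? max4 0 (- u1) (- v1) (- t1)) &&
  (b2 =? max4 0 (- u2) (- v2) (- t2)) &&
  (d - (b0 + b1 + b2) =?
   max4 0 (u0 + u1 + u2) (v0 + v1 + v2) (t0 + t1 + t2)).

Definition coordinates (d : nat) := List.map Z.of_nat (List.seq 0 d.+1).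

Definition simplex (d : nat) : list vec :=
  List.filter (fun '(x, y, z) => x + y + z <=? Z.of_nat d)
    (list_prod (list_prod (coordinates d) (coordinates d)) (coordinates d)).

(** For [d = 5] there are 56 lattice points, hence 56^4 ordered quadruples. The cross product stays
    outside the innermost loop, and the nested [if]s restrict the longer tests to unimodular
    tetrahedra. *)
Definition avoids_inverse_degree (d e : nat) :=
  forallb (fun b =>
    let edges := List.map (fun r => sub r b) (simplex d) in
    forallb (fun u => forallb (fun v =>
      let w := cross u v in
      forallb (fun t =>
        let s := dot w t in
        if Z.abs s =? 1 then
          if touches_facets (Z.of_nat d) b u v t
          then negb (inverse_degree s u v t =? Z.of_nat e) else true
        else true) edges) edges) edges) (simplex d).

Lemma avoids_inverse_degree_5_18 : avoids_inverse_degree 5 18 = true.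
Proof. by vm_compute. Qed.

Lemma in_simplex (d : nat) x y z :
  0 <= x -> 0 <= y -> 0 <= z -> x + y + z <= Z.of_nat d -> In (x, y, z) (simplex d).
Proof.
move=> x0 y0 z0 le_d.
have inZ c : 0 <= c <= Z.of_nat d -> In c (coordinates d).
  move=> cd; apply/in_map_iff; exists (Z.to_nat c); rewrite in_seq; lia.
apply/filter_In; split; last exact/Z.leb_le.
by apply/in_prod_iff; split; [apply/in_prod_iff; split|]; apply: inZ; lia.
Qed.

Lemma avoids_inverse_degreeP (d e : nat) b r1 r2 r3 :
    avoids_inverse_degree d e = true ->
    In b (simplex d) -> In r1 (simplex d) -> In r2 (simplex d) -> In r3 (simplex d) ->
    let u := sub r1 b in let v := sub r2 b in let t := sub r3 b in
    let s := dot (cross u v) t in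
    s = 1 \/ s = -1 -> touches_facets (Z.of_nat d) b u v t = true ->
  inverse_degree s u v t <> Z.of_nat e.
Proof.
move=> + ib i1 i2 i3 u v t s s1 facets; move=> /forallb_forall/(_ _ ib) /= avoid.
have edge r : In r (simplex d) -> In (sub r b) (List.map (fun r => sub r b) (simplex d)).
  by move=> ?; apply: (in_map (fun r => sub r b)).
move: avoid => /forallb_forall /(_ _ (edge _ i1)) /forallb_forall /(_ _ (edge _ i2)).
move=> /forallb_forall /(_ _ (edge _ i3)); rewrite -/u -/v -/t -/s.
have -> : Z.abs s =? 1 by apply/Z.eqb_eq; lia.
rewrite facets => + /Z.eqb_eq deg_e. by rewrite deg_e.
Qed.

Definition row3 (q : nat -> nat -> Z) v : vec := (q v 0%N, q v 1%N, q v 2%N).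
Definition column3 (p : nat -> nat -> Z) w : vec := (p 0%N w, p 1%N w, p 2%N w).
Definition det3 q := dot (cross (row3 q 0) (row3 q 1)) (row3 q 2).
Definition cofactor3 q v :=
  match v with
  | 0%N => cross (row3 q 1) (row3 q 2)
  | 1%N => cross (row3 q 2) (row3 q 0)
  | _ => cross (row3 q 0) (row3 q 1)
  end.
Definition scale s (w : vec) : vec := let '(w0, w1, w2) := w in (s * w0, s * w1, s * w2).

Lemma cramer3 (q : nat -> nat -> Z) (x : nat -> Z) v : (v < 3)%N ->
  det3 q * x v =
  dot (dot (x 0%N, x 1%N, x 2%N) (column3 q 0),
       dot (x 0%N, x 1%N, x 2%N) (column3 q 1),
       dot (x 0%N, x 1%N, x 2%N) (column3 q 2)) (cofactor3 q v).
Proof. by case: v => [|[|[]]] //= _; rewrite /det3 /cofactor3 /=; ring. Qed.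

Lemma det3M p q :
  det3 p * det3 q = det3 (fun i w => dot (row3 p i) (column3 q w)).
Proof. by rewrite /det3 /=; ring. Qed.

(** The integer determinants have product 1, so [s] is its own inverse, and Cramer's rule expresses
    [p] through the cofactors of [q]. *)
Lemma integer_inverse3 p q :
    (forall i w, (i < 3)%N -> (w < 3)%N -> dot (row3 p i) (column3 q w) = Z.b2z (i == w)) ->
  let s := det3 q in (s = 1 \/ s = -1) /\
  forall v, (v < 3)%N -> column3 p v = scale s (cofactor3 q v).
Proof.
move=> pq s.
have det1 : det3 p * s = 1.
  by rewrite det3M /det3 /row3 !pq.
have s1 : s = 1 \/ s = -1 by apply: (@Z.mul_eq_1 s (det3 p)); rewrite Z.mul_comm.
split=> // v v3.
have pE i : (i < 3)%N ->
    p i v = s * dot (Z.b2z (i == 0%N), Z.b2z (i == 1%N), Z.b2z (i == 2%N)) (cofactor3 q v).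
  move=> i3; have := cramer3 q (p i) v3; rewrite -/s -/(row3 p i) !pq // => <-.
  by case: s1 => ->; ring.
rewrite /column3 !pE //; case: (cofactor3 q v) => [[w0 w1] w2].
by rewrite /scale /dot /=; congr (_, _, _); ring.
Qed.

Definition sum4 (f : nat -> Z) := f 0%N + f 1%N + f 2%N + f 3%N.

Lemma no_exponents_of_avoids (d e : nat) (m a : nat -> nat -> Z) :
    avoids_inverse_degree d e = true ->
    (forall i j, 0 <= m i j) -> (forall i j, 0 <= a i j) ->
    (forall i, (i < 4)%N -> sum4 (m i) = Z.of_nat d) ->
    (forall i, (i < 4)%N -> sum4 (a i) = Z.of_nat e) ->
    (forall j, (j < 4)%N -> exists2 i, (i < 4)%N & m i j = 0) ->
    (forall j, (j < 4)%N -> exists2 i, (i < 4)%N & a i j = 0) ->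
    (forall i j w, (i < 4)%N -> (j < 4)%N -> (w < 4)%N ->
      sum4 (fun v => a i v * m v w) + Z.b2z (j == w) =
      sum4 (fun v => a j v * m v w) + Z.b2z (i == w)) ->
  False.
Proof.
move=> avoid m_ge0 a_ge0 sum_m sum_a m_min a_min am.
pose p i v := a i v - a 3%N v; pose q v w := m v w - m 3%N w.
(* Row 3 is the base vertex. As all rows of [a] have the same sum, the fourth entry of a difference
   of rows is minus the sum of the others, which replaces [m] by [q]. *)
have pq i w : (i < 3)%N -> (w < 3)%N -> dot (row3 p i) (column3 q w) = Z.b2z (i == w).
  move=> i3 w3; have := am i 3%N w (ltnW i3) isT (ltnW w3).
  rewrite (_ : 3%N == w = false); last by rewrite gtn_eqF.
  move: (sum_a i (ltnW i3)) (sum_a 3%N isT); rewrite /sum4 /dot /= /p /q.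
  move=> ei e3.
  have -> : a i 3%N = Z.of_nat e - (a i 0%N + a i 1%N + a i 2%N) by lia.
  have -> : a 3%N 3%N = Z.of_nat e - (a 3%N 0%N + a 3%N 1%N + a 3%N 2%N) by lia.
  lia.
have [s1 col] := integer_inverse3 pq; set s := det3 q in s1 col.
have in_m i : (i < 4)%N -> In (row3 m i) (simplex d).
  move=> i4; have := sum_m i i4; rewrite /sum4 => sum_mi.
  by apply: in_simplex => //; have := m_ge0 i 3%N; lia.
(* A column with minimum 0 is determined by its differences: the base entry is the largest drop from
   it. *)
have col_min (f : nat -> nat -> Z) j : (forall i j, 0 <= f i j) ->
    (exists2 i, (i < 4)%N & f i j = 0) ->
    f 3%N j = max4 0 (- (f 0%N j - f 3%N j)) (- (f 1%N j - f 3%N j)) (- (f 2%N j - f 3%N j)).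
  move=> f0 [i i4 fi]; move: (f0 0%N j) (f0 1%N j) (f0 2%N j) (f0 3%N j).
  by case: i i4 fi => [|[|[|[]]]] // _; rewrite /max4; lia.
have m_col j (j4 : (j < 4)%N) := col_min m j m_ge0 (m_min j j4).
have a_col j (j4 : (j < 4)%N) := col_min a j a_ge0 (a_min j j4).
(* By [col] and [a_col], the four depths are the entries of row 3 of [a], whose sum is [e]. *)
have deg_e : inverse_degree s (row3 q 0) (row3 q 1) (row3 q 2) = Z.of_nat e.
  move: (col 0%N isT) (col 1%N isT) (col 2%N isT); rewrite /inverse_degree /cofactor3.
  case: (cross (row3 q 1) (row3 q 2)) => [[x0 x1] x2].
  case: (cross (row3 q 2) (row3 q 0)) => [[y0 y1] y2].
  case: (cross (row3 q 0) (row3 q 1)) => [[z0 z1] z2].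
  rewrite /column3 /scale /depth => -[x0E x1E x2E] -[y0E y1E y2E] -[z0E z1E z2E].
  rewrite !Z.mul_opp_r !Z.mul_add_distr_l -x0E -x1E -x2E -y0E -y1E -y2E -z0E -z1E -z2E.
  rewrite /p -!a_col //; have := a_col 3%N isT.
  move: (sum_a 0%N isT) (sum_a 1%N isT) (sum_a 2%N isT) (sum_a 3%N isT).
  by rewrite /sum4 /max4; lia.
apply: (avoids_inverse_degreeP avoid (in_m 3%N isT) (in_m 0%N isT) (in_m 1%N isT)
  (in_m 2%N isT) s1 _ deg_e).
rewrite /touches_facets /=; rewrite -!m_col // !Z.eqb_refl /=.
apply/Z.eqb_eq; have := m_col 3%N isT.
move: (sum_m 0%N isT) (sum_m 1%N isT) (sum_m 2%N isT) (sum_m 3%N isT).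
by rewrite /sum4 /max4; lia.
Qed.

End DegreeGap.

(** * Transfer to integer matrices, and certificates for explicit maps *)

Section ExplicitExponents.

Lemma sum_inord4 (F : 'I_4 -> nat) :
  \sum_i F i = F (inord 0) + F (inord 1) + F (inord 2) + F (inord 3).
Proof.
rewrite !big_ord_recl big_ord0 addn0 !addnA.
by congr (F _ + F _ + F _ + F _); apply: val_inj; rewrite /= inordK.
Qed.

Lemma inord4_eq i j : i < 4 -> j < 4 -> ((inord i : 'I_4) == inord j) = (i == j).
Proof. by move=> i4 j4; rewrite -val_eqE /= !inordK. Qed.

Lemma no_inverse_degree_of_avoids (k : closedFieldType) (d e : nat) :
  avoids_inverse_degree d e = true -> ~ inverse_degrees k 3 d e.
Proof.
move=> avoid /exponents_of_inverse_degrees[a [b [da eb a0 b0 ba]]].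
pose entry (c : 'I_4 -> 'X_{1..4}) i j := Z.of_nat (c (inord i) (inord j)).
have entry_ge0 c i j : Z.le Z0 (entry c i j) by rewrite /entry; lia.
have entry_sum c s : (forall i, mdeg (c i) = s) ->
    forall i, i < 4 -> sum4 (entry c i) = Z.of_nat s.
  move=> cs i _; rewrite /sum4 /entry.
  by have := cs (inord i); rewrite mdegE sum_inord4; lia.
have entry_min c : no_common_variable c ->
    forall j, j < 4 -> exists2 i, i < 4 & entry c i j = Z0.
  move=> c0 j _; have [i ci] := c0 (inord j); exists i => //.
  by rewrite /entry inord_val ci.
apply: (no_exponents_of_avoids avoid (entry_ge0 a) (entry_ge0 b)
  (entry_sum a d da) (entry_sum b e eb) (entry_min a a0) (entry_min b b0)).
move=> i j w i4 j4 w4; have /mnmP/(_ (inord w)) := ba (inord i) (inord j).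
rewrite !mnmDE !subst_exponentE !sum_inord4 !mnm1E !inord4_eq // /sum4 /entry.
have ZD x y : Z.of_nat (x + y) = Z.add (Z.of_nat x) (Z.of_nat y) by exact: Nat2Z.inj_add.
have ZM x y : Z.of_nat (x * y) = Z.mul (Z.of_nat y) (Z.of_nat x).
  by rewrite mulnC; exact: Nat2Z.inj_mul.
have Zb (c : bool) : Z.of_nat c = Z.b2z c by case: c.
by move/(congr1 Z.of_nat); rewrite !ZD !ZM !Zb.
Qed.

Definition entry (s : seq (seq nat)) i j := nth 0 (nth [::] s i) j.

Definition exponents_of_rows s (i : 'I_4) : 'X_{1..4} := [multinom entry s i j | j < 4].

Definition reduced_of_degree s d :=
  all (fun i => sumn [seq entry s i j | j <- iota 0 4] == d) (iota 0 4) &&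
  all (fun j => has (fun i => entry s i j == 0) (iota 0 4)) (iota 0 4).

(** Boolean form of [left_inverse_exponent], decided by computation; [sumn] matches the nested sums
    that [big_ord_recl] produces. *)
Definition inverts t s := all (fun i => all (fun j => all (fun w =>
  sumn [seq entry s v w * entry t i v | v <- iota 0 4] + (j == w) ==
  sumn [seq entry s v w * entry t j v | v <- iota 0 4] + (i == w))
  (iota 0 4)) (iota 0 4)) (iota 0 4).

Lemma all_iota4P (P : pred nat) : all P (iota 0 4) -> forall i : 'I_4, P i.
Proof. by move=> /allP all_P i; rewrite all_P // mem_iota ltn_ord. Qed.

Lemma inverts_left_inverse s t :
  inverts t s -> left_inverse_exponent (exponents_of_rows t) (exponents_of_rows s).
Proof.
move=> ts i j; apply/mnmP => w.
have /all_iota4P/(_ j)/all_iota4P/(_ w)/eqP := all_iota4P ts i.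
by rewrite !mnmDE !subst_exponentE !mnm1E !big_ord_recl !big_ord0 !mnmE.
Qed.

Lemma inverse_degrees_of_rows (k : closedFieldType) s t d e :
    reduced_of_degree s d -> reduced_of_degree t e -> inverts s t -> inverts t s ->
  inverse_degrees k 3 d e.
Proof.
move=> sd te st ts.
have mdeg_rows r c : reduced_of_degree r c -> forall i, mdeg (exponents_of_rows r i) = c.
  case/andP=> rc _ i; rewrite mdegE -(eqP (all_iota4P rc i)).
  by rewrite !big_ord_recl big_ord0 !mnmE.
have no_common r c : reduced_of_degree r c -> no_common_variable (exponents_of_rows r).
  case/andP=> _ r0 j; have /hasP[i] := all_iota4P r0 j.
  rewrite mem_iota => /= i4 /eqP ri; by exists (inord i); rewrite mnmE inordK.
by apply: (inverse_degrees_of_exponents k (mdeg_rows s d sd) (mdeg_rows t e te)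
  (no_common s d sd) (no_common t e te)); apply: inverts_left_inverse.
Qed.

End ExplicitExponents.

Theorem mainTheorem4 (k : closedFieldType) :
  exists n d : nat, [/\ 2 <= n, 1 <= d &
    exists a b c : nat,
      [/\ a < b, b < c, inverse_degrees k n d a, inverse_degrees k n d c &
          ~ inverse_degrees k n d b]].
Proof.
exists 3, 5; split=> //; exists 17, 18, 19; split=> //.
(* Each row lists the exponents of one component: first those of the map, of degree 5, then those of
   its inverse, of degree 17 here and 19 below. *)
- by apply: (@inverse_degrees_of_rows k
    [:: [:: 0; 0; 0; 5]; [:: 0; 0; 1; 4]; [:: 0; 1; 4; 0]; [:: 1; 3; 0; 1]]
    [:: [:: 0; 16; 0; 1]; [:: 13; 0; 4; 0]; [:: 9; 5; 3; 0]; [:: 10; 4; 3; 0]]).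
- by apply: (@inverse_degrees_of_rows k
    [:: [:: 0; 0; 0; 5]; [:: 0; 1; 3; 1]; [:: 1; 1; 3; 0]; [:: 4; 0; 1; 0]]
    [:: [:: 1; 10; 5; 3]; [:: 3; 0; 16; 0]; [:: 0; 15; 0; 4]; [:: 1; 11; 4; 3]]).
- exact: no_inverse_degree_of_avoids avoids_inverse_degree_5_18.
Qed.
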